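(* Assume the grading is strong. Let $\underline C_{k-1}$ be a quotient-up-component in dimension $k-1$ that is not a leaf, and let $\underline C_k=\{\underline u\in\underline X_k:\underline u\supset\underline t\text{ for some }\underline t\in\underline C_{k-1}\}$ be the corresponding quotient-down-component (not a root). Let $C_{k-1}=\{t:\underline t\in\underline C_{k-1}\}$, $C_k=\{u:\underline u\in\underline C_k\}$. The following are equivalent: (1) the up-walk is not aperiodic on $C_{k-1}$; (2) the down-walk is not aperiodic on $C_k$; (3) $-1$ is an eigenvalue of $A^{\mathcal O(\underline C_{k-1}),\mathrm{up}}_{k-1}$; (4) $-1$ is an eigenvalue of $A^{\mathcal O(\underline C_k),\mathrm{down}}_k$; (5) $\underline C_{k-1}$ is a coherent-up-component; (6) $\underline C_k$ is a coherent-down-component. In this case $-1$ has multiplicity one for both operators; moreover, if $\mathcal O$ witnesses the coherence of $\underline C_{k-1}$ and additionally satisfies $[v:u]=1$ for all $u\in\mathcal O(\underline C_{k-1})$ and $v\in\mathcal O(\underline X_k)$ with $u\subset v$, then the corresponding eigenfunction of $A^{\mathcal O(\underline C_{k-1}),\mathrm{up}}_{k-1}$ is, up to a constant, $g(t)=(\mathrm{LP}(\underline t)\mathrm{RP}(\underline t))^{1/2}$, and that of $A^{\mathcal O(\underline C_k),\mathrm{down}}_k$ is, up to a constant, $f(u)=(\mathrm{LP}(\underline u)\mathrm{RP}(\underline u))^{1/2}$.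
   Context: A double cover of a graded signed graph is $\Gamma=(X,E,[\cdot:\cdot],\dim,-)$: $X$ finite nonempty, $E$ directed edges ($u\subset v$), signature $[v:u]\in\{\pm1\}$, $\dim:X\to\mathbb Z$, $-$ a fixed-point-free involution, with $u\subset v\Rightarrow\dim u<\dim v$, $-u\subset v$, $u\subset-v$, $[-v:u]=[v:-u]=-[v:u]$, and $\dim(-u)=\dim u$. Strong grading: $u\subset v\Rightarrow\dim v=\dim u+1$. Quotient $\underline\Gamma$: nodes $\underline u=\{u,-u\}$, edges $\underline u\subset\underline v$ iff $u\subset v$; $X_k,\underline X_k$ nodes of dimension $k$. Leaf: no $\underline v\supset\underline u$; root: no $\underline t\subset\underline u$. $\mathrm{LP}=1$ on leaves, $\sum_{\underline v\supset\underline u}\mathrm{LP}(\underline v)$ otherwise; $\mathrm{RP}=1$ on roots, $\sum_{\underline t\subset\underline u}\mathrm{RP}(\underline t)$ otherwise; $H=\mathrm{LP}/\mathrm{RP}$. An orientation is $\mathcal O$ with $\mathcal O(\underline u)\in\{u,-u\}$. Up-adjacency: distinct nodes of $\underline X_k$ below a common node of $\underline X_{k+1}$; down-adjacency: distinct nodes of $\underline X_k$ above a common node of $\underline X_{k-1}$. Quotient-up-(down-)components in dimension $k$: maximal up-(down-)connected subsets of $\underline X_k$; ''not a leaf/root'' means not a single leaf/root. A quotient-up-component $\underline C$ in dimension $j$ is coherent if it is not a leaf and some orientation has $[v:u]=[v:u']$ for all $u,u'\in\mathcal O(\underline C)$, $v\in X_{j+1}$ with $u,u'\subset v$; a quotient-down-component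 is coherent if it is not a root and some orientation has $[u:t]=[u':t]$ for all $u,u'\in\mathcal O(\underline C)$, $t\in X_{j-1}$ with $t\subset u,u'$. Operators: for $u,u'\in\mathcal O(\underline X_k)$, $(A^{\mathcal O,\mathrm{up}}_k)_{uu'}=-H(\underline u)^{-1/2}H(\underline u')^{-1/2}\sum_{\underline v\supset\underline u,\underline u'}[v:u][v:u']H(\underline v)$ if $\underline u,\underline u'$ are up-adjacent or $\underline u=\underline u'$ is not a leaf, $0$ otherwise; $(A^{\mathcal O,\mathrm{down}}_k)_{uu'}=-H(\underline u)^{1/2}H(\underline u')^{1/2}\sum_{\underline t\subset\underline u,\underline u'}[u:t][u':t]H(\underline t)^{-1}$ if down-adjacent or $\underline u=\underline u'$ not a root, $0$ otherwise ($v=\mathcal O(\underline v)$, $t=\mathcal O(\underline t)$). $A^{\mathcal O(\underline C),\mathrm{up}}_k$ denotes the principal submatrix indexed by $\mathcal O(\underline C)$, similarly for down. Up-walk on $X_k$: for $\underline u$ not a leaf, $P(u,u')=\sum\frac{\mathrm{LP}(\underline v)\mathrm{RP}(\underline u')}{\mathrm{LP}(\underline u)\mathrm{RP}(\underline v)}$ over $v\in X$ with $v\supset u,u'$, $[v:u]=1$, $[v:u']=-1$; for leaves $P(u,\pm u)=1/2$. Down-walk: for $\underline u$ not a root, $P(u,u')=\sum\frac{\mathrm{RP}(\underline t)\mathrm{LP}(\underline u')}{\mathrm{RP}(\underline u)\mathrm{LP}(\underline t)}$ over $t\subset u,u'$ with $[u:t]=-1$, $[u':t]=1$; for roots $P(u,\pm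 u)=1/2$. *)

(* Defs.v *)
From HB Require Import structures.
From mathcomp Require Import all_boot all_order all_algebra.
From mathcomp Require Import reals.

Set Implicit Arguments.
Unset Strict Implicit.
Unset Printing Implicit Defensive.

Import Order.TTheory GRing.Theory Num.Theory.
Local Open Scope ring_scope.

(* [sub u v] is u ⊂ v and [sgn v u] is the signature [v:u]; the latter is
   only meaningful on edges, its values elsewhere are never used. *)
Record doubleCover := DoubleCover {
  node :> finType;
  sub : rel node;
  sgn : node -> node -> int;
  dim : node -> int;
  neg : node -> node;
  node_nonempty : (0 < #|node|)%N;
  negK : involutive neg;
  neg_neq : forall u, neg u != u;
  sgnP : forall u v, sub u v -> sgn v u = 1 \/ sgn v u = -1;
  sub_dim : forall u v, sub u v -> dim u < dim v;
  sub_negl : forall u v, sub u v -> sub (neg u) v;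
  sub_negr : forall u v, sub u v -> sub u (neg v);
  sgn_negl : forall u v, sub u v -> sgn (neg v) u = - sgn v u;
  sgn_negr : forall u v, sub u v -> sgn v (neg u) = - sgn v u;
  dim_neg : forall u, dim (neg u) = dim u
}.

Arguments sub {d}.
Arguments sgn {d}.
Arguments dim {d}.
Arguments neg {d}.

Definition strong_grading (G : doubleCover) :=
  forall u v : G, sub u v -> dim v = dim u + 1.

Record qnode (G : doubleCover) := QNode {
  fiber : {set G};
  fiberP : [exists u : G, fiber == [set u; neg u]]
}.

HB.instance Definition _ (G : doubleCover) := [isSub for @fiber G].
HB.instance Definition _ (G : doubleCover) := [Finite of qnode G by <:].

Section Quotient.
Variable G : doubleCover.
Implicit Types (u v t : G) (a b c : qnode G) (C D : {set qnode G}) (k : int).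

Lemma clsP u : [exists w : G, [set u; neg u] == [set w; neg w]].
Proof. by apply/existsP; exists u. Qed.

Definition cls u : qnode G := QNode (clsP u).

Definition qsub a b := [exists u in fiber a, exists v in fiber b, sub u v].

Definition layer k : {set G} := [set u | dim u == k].

Definition qlayer k : {set qnode G} :=
  [set a | [forall u in fiber a, dim u == k]].

Definition leaf a := ~~ [exists b, qsub a b].
Definition root a := ~~ [exists b, qsub b a].

(* LP and RP are defined by recursion along the grading; as a chain of edges
   visits each node at most once, #|{: qnode G}| is enough fuel.  The defining
   recursive equations are lemmas [LPE] and [RPE] below. *)
Fixpoint LP_rec n a : nat :=
  if n is m.+1 then
    if leaf a then 1%N else (\sum_(b | qsub a b) LP_rec m b)%N
  else 0%N.

Fixpoint RP_rec n a : nat :=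
  if n is m.+1 then
    if root a then 1%N else (\sum_(b | qsub b a) RP_rec m b)%N
  else 0%N.

Definition LP a : nat := LP_rec #|{: qnode G}| a.
Definition RP a : nat := RP_rec #|{: qnode G}| a.

Lemma qsub_cls u v : qsub (cls u) (cls v) = sub u v.
Proof.
apply/idP/idP; last first.
  by move=> uv; apply/exists_inP; exists u; rewrite ?inE ?eqxx //;
     apply/exists_inP; exists v; rewrite ?inE ?eqxx.
move=> /exists_inP[x]; rewrite !inE => xu /exists_inP[y]; rewrite !inE => yv.
case/orP: xu => /eqP->; case/orP: yv => /eqP-> //.
- by move/sub_negr; rewrite negK.
- by move/sub_negl; rewrite negK.
- by move/sub_negl/sub_negr; rewrite !negK.
Qed.

Lemma cls_surj a : exists u, a = cls u.
Proof.
by case: (existsP (fiberP a)) => u /eqP au; exists u; apply: val_inj.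
Qed.

Lemma in_qlayer_cls k u : (cls u \in qlayer k) = (dim u == k).
Proof.
rewrite inE; apply/forall_inP/idP => [|uk x]; first by apply; rewrite !inE eqxx.
by rewrite !inE => /orP[] /eqP->; rewrite ?dim_neg.
Qed.

Let qdim a : int := if [pick u in fiber a] is Some u then dim u else 0.

Let qdim_cls u : qdim (cls u) = dim u.
Proof.
rewrite /qdim; case: pickP => [x|/(_ u)]; last by rewrite !inE eqxx.
by rewrite !inE => /orP[] /eqP->; rewrite ?dim_neg.
Qed.

Let qsub_qdim a b : qsub a b -> qdim a < qdim b.
Proof.
have [[u ->] [v ->]] := (cls_surj a, cls_surj b).
by rewrite qsub_cls !qdim_cls; apply: sub_dim.
Qed.

Let rankU a := #|[set b | qdim a < qdim b]|.
Let rankD a := #|[set b | qdim b < qdim a]|.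

Let rankU_lt a b : qsub a b -> (rankU b < rankU a)%N.
Proof.
move=> /qsub_qdim ab; apply: proper_card; apply/properP; split.
  by apply/subsetP => x; rewrite !inE; apply: lt_trans.
by exists b; rewrite !inE ?ltxx.
Qed.

Let rankD_lt a b : qsub b a -> (rankD b < rankD a)%N.
Proof.
move=> /qsub_qdim ab; apply: proper_card; apply/properP; split.
  by apply/subsetP => x; rewrite !inE => xb; apply: lt_trans ab.
by exists b; rewrite !inE ?ltxx.
Qed.

Let rankU_max a : (rankU a < #|{: qnode G}|)%N.
Proof.
rewrite -cardsT; apply: proper_card; apply/properP; split; first exact: subsetT.
by exists a; rewrite !inE ?ltxx.
Qed.

Let rankD_max a : (rankD a < #|{: qnode G}|)%N.
Proof.
rewrite -cardsT; apply: proper_card; apply/properP; split; first exact: subsetT.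
by exists a; rewrite !inE ?ltxx.
Qed.

Lemma LPE a : LP a = if leaf a then 1%N else (\sum_(b | qsub a b) LP b)%N.
Proof.
have stab n m c : (rankU c < n)%N -> (rankU c < m)%N -> LP_rec n c = LP_rec m c.
  elim: n m c => // n IH [//|m] c cn cm /=; case: ifP => // _.
  apply: eq_bigr => b /rankU_lt bc.
  by apply: IH; apply: leq_trans bc _.
transitivity (LP_rec #|{: qnode G}|.+1 a) => //.
by apply: stab; rewrite ?ltnS; [|apply: ltnW]; apply: rankU_max.
Qed.

Lemma RPE a : RP a = if root a then 1%N else (\sum_(b | qsub b a) RP b)%N.
Proof.
have stab n m c : (rankD c < n)%N -> (rankD c < m)%N -> RP_rec n c = RP_rec m c.
  elim: n m c => // n IH [//|m] c cn cm /=; case: ifP => // _.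
  apply: eq_bigr => b /rankD_lt bc.
  by apply: IH; apply: leq_trans bc _.
transitivity (RP_rec #|{: qnode G}|.+1 a) => //.
by apply: stab; rewrite ?ltnS; [|apply: ltnW]; apply: rankD_max.
Qed.

Definition up_adj k : rel (qnode G) := fun a b =>
  [&& a \in qlayer k, b \in qlayer k, a != b &
      [exists c in qlayer (k + 1), qsub a c && qsub b c]].

Definition down_adj k : rel (qnode G) := fun a b =>
  [&& a \in qlayer k, b \in qlayer k, a != b &
      [exists c in qlayer (k - 1), qsub c a && qsub c b]].

Definition connected_in (e : rel (qnode G)) k C :=
  [&& C != set0, C \subset qlayer k &
      [forall a in C, forall b in C,
         connect (fun x y => [&& x \in C, y \in C & e x y]) a b]].

Definition up_component k C := maxset (connected_in (up_adj k) k) C.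
Definition down_component k C := maxset (connected_in (down_adj k) k) C.

Definition single_leaf C := [exists a, leaf a && (C == [set a])].
Definition single_root C := [exists a, root a && (C == [set a])].

(* C_k from C_{k-1}. *)
Definition above k C : {set qnode G} :=
  [set a in qlayer k | [exists b in C, qsub b a]].

Definition lift_set C : {set G} := [set u | cls u \in C].

Definition orientation (O : qnode G -> G) := forall a, O a \in fiber a.

Definition coherent_up_by k C (O : qnode G -> G) :=
  forall u u' v, u \in O @: C -> u' \in O @: C -> v \in layer (k + 1) ->
    sub u v -> sub u' v -> sgn v u = sgn v u'.

Definition coherent_down_by k C (O : qnode G -> G) :=
  forall u u' t, u \in O @: C -> u' \in O @: C -> t \in layer (k - 1) ->
    sub t u -> sub t u' -> sgn u t = sgn u' t.

Definition coherent_up k C :=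
  [/\ up_component k C, ~~ single_leaf C &
      exists2 O, orientation O & coherent_up_by k C O].

Definition coherent_down k C :=
  [/\ down_component k C, ~~ single_root C &
      exists2 O, orientation O & coherent_down_by k C O].

Variable R : realType.

Definition LPR a : R := (LP a)%:R.
Definition RPR a : R := (RP a)%:R.
Definition Hratio a : R := LPR a / RPR a.

Definition A_up (O : qnode G -> G) k u u' : R :=
  if up_adj k (cls u) (cls u') || (cls u == cls u') && ~~ leaf (cls u) then
    - ((Num.sqrt (Hratio (cls u)))^-1 * (Num.sqrt (Hratio (cls u')))^-1 *
       \sum_(b | qsub (cls u) b && qsub (cls u') b)
          (sgn (O b) u)%:~R * (sgn (O b) u')%:~R * Hratio b)
  else 0.

Definition A_down (O : qnode G -> G) k u u' : R :=
  if down_adj k (cls u) (cls u') || (cls u == cls u') && ~~ root (cls u) then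
    - (Num.sqrt (Hratio (cls u)) * Num.sqrt (Hratio (cls u')) *
       \sum_(b | qsub b (cls u) && qsub b (cls u'))
          (sgn u (O b))%:~R * (sgn u' (O b))%:~R * (Hratio b)^-1)
  else 0.

Definition up_walk u u' : R :=
  if leaf (cls u) then (if (u' == u) || (u' == neg u) then 2^-1 else 0)
  else \sum_(v | [&& sub u v, sub u' v, sgn v u == 1 & sgn v u' == -1])
         (LPR (cls v) * RPR (cls u')) / (LPR (cls u) * RPR (cls v)).

Definition down_walk u u' : R :=
  if root (cls u) then (if (u' == u) || (u' == neg u) then 2^-1 else 0)
  else \sum_(t | [&& sub t u, sub t u', sgn u t == -1 & sgn u' t == 1])
         (RPR (cls t) * LPR (cls u')) / (RPR (cls u) * LPR (cls t)).

Definition sqrtLR u : R := Num.sqrt (LPR (cls u) * RPR (cls u)).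

End Quotient.

Arguments A_up {G R}.
Arguments A_down {G R}.
Arguments up_walk {G R}.
Arguments down_walk {G R}.
Arguments sqrtLR {G R}.

Section Generic.
Variables (R : realType) (T : finType).

Definition principal (S : {set T}) (F : T -> T -> R) : 'M[R]_#|S| :=
  \matrix_(i, j) F (enum_val i) (enum_val j).

Definition restr_fun (S : {set T}) (f : T -> R) : 'cV[R]_#|S| :=
  \col_i f (enum_val i).

(* n-step transition probabilities of a chain with state space S. *)
Fixpoint nstep (S : {set T}) (P : T -> T -> R) n x y : R :=
  if n is m.+1 then \sum_(z in S) P x z * nstep S P m z y else (x == y)%:R.

(* d is the gcd of the return times of x. *)
Definition is_period (S : {set T}) (P : T -> T -> R) (x : T) (d : nat) :=
  forall e : nat, (e %| d)%N <->
    (forall n, (0 < n)%N -> 0 < nstep S P n x x -> (e %| n)%N).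

Definition aperiodic_on (S : {set T}) (P : T -> T -> R) (C : {set T}) :=
  forall x, x \in C -> is_period S P x 1.

End Generic.

Section Eigen.
Variables (R : realType) (n : nat).

Definition eigenvector (A : 'M[R]_n) (a : R) (f : 'cV[R]_n) :=
  f != 0 /\ A *m f = a *: f.

(* Algebraic and geometric multiplicity (they agree for the symmetric matrices
   considered here). *)
Definition multiplicity_one (A : 'M[R]_n) (a : R) :=
  mup a (char_poly A) = 1%N /\ \rank (eigenspace A a) = 1%N.

End Eigen.

(* Main.v *)
Require Import Defs.
From HB Require Import structures.
From mathcomp Require Import all_boot all_order all_algebra.
From mathcomp Require Import reals boolp ring.

Set Implicit Arguments.
Unset Strict Implicit.
Unset Printing Implicit Defensive.

Import Order.TTheory GRing.Theory Num.Theory.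
Local Open Scope ring_scope.

(* With [B] the signed incidence matrix between [O @: D] and [O @: C], weighted
   by [sqrt (H v / H u)], the two operators are [- B^T B] and [- B B^T], and
   [sqrtLR] is a singular vector pair, of singular value 1, of the entrywise
   absolute value [|B|].  A sum of squares shows that [(g, f)] is a singular
   pair of [B] itself iff the signs of [B] are the products of the signs of
   [g / sqrtLR] and [f / sqrtLR]; by connectedness such a pair is nowhere zero
   and unique up to a scalar.  Its signs are exactly the reorientations that
   make [C], or [D], coherent.  On the side of the walks, one step joins two
   nodes having opposite signs with respect to a common neighbour, so that a
   coherent orientation is a 2-colouring of the walk; as [u] and [- u] are
   always joined, the period is 1 or 2 and it is 2 iff the walk is bipartite. *)

(** * Simple eigenvalues and singular pairs *)

(** Border ['X - A] with the column [g] and the row [h]. Eliminating the border column by means of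
    [A g = a g] gives [det N * -('X - a) = char_poly A * (h g)], so [a] is a simple root as soon as
    [N] is invertible at [a]. *)
Lemma mup_char_poly_simple (F : fieldType) n (A : 'M[F]_n) a
    (h : 'rV[F]_n) (g : 'cV[F]_n) :
    A *m g = a *: g -> (h *m g) 0 0 != 0 ->
    (forall w : 'rV_n, w *m A = a *: w -> exists c, w = c *: h) ->
  mup a (char_poly A) = 1%N.
Proof.
move=> Ag hg simple.
pose gX := map_mx polyC g; pose hX := map_mx polyC h.
pose N := block_mx (char_poly_mx A) gX hX (0 : 'M[{poly F}]_1).
have XAg : char_poly_mx A *m gX = ('X - a%:P) *: gX.
  rewrite mulmxBl mul_scalar_mx -map_mxM Ag scalerBl; congr (_ - _).
  by rewrite map_mxZ.
have detN : \det N * - ('X - a%:P) = char_poly A * ((h *m g) 0 0)%:P.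
  have -> : - ('X - a%:P) = \det (block_mx 1%:M gX (0 : 'M_(1, n))
      (- ('X - a%:P))%:M).
    by rewrite det_ublock det1 mul1r det_scalar1.
  rewrite -det_mulmx mulmx_block !mulmx0 !mulmx1 !addr0 XAg mul0mx addr0.
  have -> : gX *m (- ('X - a%:P))%:M = - (('X - a%:P) *: gX).
    by rewrite mul_mx_scalar scaleNr.
  rewrite subrr det_lblock /char_poly; congr (_ * _).
  by rewrite det_mx11 -map_mxM mxE.
(* A row [(w1, w2)] in the left kernel of [N] at [a] satisfies [w1 (a - A) + w2 h = 0] and
   [w1 g = 0]. Multiplying the first equation by [g] kills [w2]; then [w1] is a multiple of [h], and
   [w1 g = 0] kills it too. *)
have Na : (\det N).[a] != 0.
  have -> : (\det N).[a] = \det (block_mx (a%:M - A) g h (0 : 'M_1)).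
    rewrite -[LHS]/(horner_eval a (\det N)) -det_map_mx map_block_mx.
    congr (\det (block_mx _ _ _ _)); apply/matrixP => i j;
      by rewrite !mxE /= /horner_eval !hornerE ?hornerMn ?hornerX.
  rewrite -unitfE -unitmxE -row_free_unit -kermx_eq0; apply/rowV0P => w.
  rewrite -[w]hsubmxK; set w1 := lsubmx w; set w2 := rsubmx w.
  move/sub_kermxP; rewrite mul_row_block mulmx0 addr0 -[0]row_mx0.
  case/eq_row_mx => e1 e2.
  have w20 : w2 = 0.
    move/(congr1 (mulmx^~ g)): e1; rewrite mulmxDl mul0mx -mulmxA mulmxBl.
    rewrite mul_scalar_mx Ag subrr mulmx0 add0r -mulmxA => /matrixP/(_ 0 0).
    rewrite mxE big_ord1 [RHS]mxE => /eqP; rewrite mulf_eq0 (negPf hg) orbF.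
    by move=> /eqP w2E; apply/matrixP => i j; rewrite !ord1 w2E mxE.
  have [c w1E] : exists c, w1 = c *: h.
    apply: simple; move: e1; rewrite w20 mul0mx addr0 mulmxBr mul_mx_scalar.
    by move/eqP; rewrite subr_eq0 => /eqP.
  move: e2; rewrite w1E w20 -scalemxAl => /matrixP/(_ 0 0).
  rewrite mxE [RHS]mxE => /eqP; rewrite mulf_eq0 (negPf hg) orbF => /eqP->.
  by rewrite scale0r row_mx0.
have N0 : \det N != 0 by apply: contraNneq Na => ->; rewrite horner0.
have c0 : ~~ root (((h *m g) 0 0)%:P) a by rewrite /root hornerC.
rewrite -(mupMl _ c0) -detN mulrN -mulNr mupMr ?rootE ?hornerN ?oppr_eq0 //.
by rewrite -['X - _]expr1 mup_XsubCX eqxx.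
Qed.

Lemma dotmx_gt0 (R : realDomainType) n (g : 'cV[R]_n) :
  g != 0 -> 0 < (g^T *m g) 0 0.
Proof.
move=> g0; rewrite lt0r mxE; under eq_bigr => i _ do rewrite mxE.
have sq i : 0 <= g i 0 * g i 0 by rewrite -expr2 sqr_ge0.
rewrite sumr_ge0 // andbT; apply: contraNneq g0 => /psumr_eq0P z.
apply/eqP/matrixP => i j; rewrite !ord1 mxE.
by apply/eqP; move/eqP: (z (fun i _ => sq i) i isT); rewrite mulf_eq0 orbb.
Qed.

Lemma eigenvalue_sym (F : fieldType) n (A : 'M[F]_n) a : A^T = A ->
  eigenvalue A a <-> exists2 g : 'cV_n, g != 0 & A *m g = a *: g.
Proof.
move=> As; split=> [/eigenvalueP[w wA w0]|[g g0 Ag]].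
  exists w^T; first by rewrite trmx_eq0.
  by rewrite -{1}As -trmx_mul wA linearZ.
apply/eigenvalueP; exists g^T; last by rewrite trmx_eq0.
by rewrite -{1}As -trmx_mul Ag linearZ.
Qed.

(** By symmetry [g^T] spans the left eigenspace, and [g^T g > 0] over the reals, so the bordering
    argument applies with [h = g^T]. *)
Lemma multiplicity_one_sym (R : realType) n (A : 'M[R]_n) a (g : 'cV_n) :
    A^T = A -> g != 0 -> A *m g = a *: g ->
    (forall w : 'cV_n, A *m w = a *: w -> exists c, w = c *: g) ->
  multiplicity_one A a.
Proof.
move=> As g0 Ag simple.
have simpleT (w : 'rV_n) : w *m A = a *: w -> exists c, w = c *: g^T.
  move=> /(congr1 trmx); rewrite trmx_mul As linearZ /= => /simple[c wE].
  by exists c; rewrite -[w]trmxK wE linearZ.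
split.
  apply: (mup_char_poly_simple (h := g^T) Ag) => //.
  by rewrite gt_eqF // dotmx_gt0.
have -> : \rank (eigenspace A a) = \rank g^T; last first.
  by rewrite rank_rV trmx_eq0 g0.
apply/eqP; rewrite eqn_leq; apply/andP; split; apply: mxrankS; last first.
  by apply/eigenspaceP; rewrite -{1}As -trmx_mul Ag linearZ.
apply/rV_subP => w /eigenspaceP/simpleT[c ->].
exact: scalemx_sub.
Qed.

(** * Singular pairs of a matrix whose absolute value has a positive singular pair *)

Section SingularPairs.
Variables (R : realType) (m n : nat) (B : 'M[R]_(m, n)).
Variables (g0 : 'cV[R]_n) (f0 : 'cV[R]_m).
Hypothesis g0_gt0 : forall u, 0 < g0 u 0.
Hypothesis f0_gt0 : forall v, 0 < f0 v 0.
Hypothesis Bg0 : map_mx Num.norm B *m g0 = f0.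
Hypothesis Bf0 : (map_mx Num.norm B)^T *m f0 = g0.

Definition singular_pair (g : 'cV[R]_n) (f : 'cV[R]_m) :=
  B *m g = f /\ B^T *m f = g.

Let Bg0E v : \sum_u `|B v u| * g0 u 0 = f0 v 0.
Proof. by rewrite -[in RHS]Bg0 mxE; apply: eq_bigr => u _; rewrite mxE. Qed.

Let Bf0E u : \sum_v `|B v u| * f0 v 0 = g0 u 0.
Proof. by rewrite -[in RHS]Bf0 mxE; apply: eq_bigr => v _; rewrite !mxE. Qed.

(* For a singular pair, the nonnegative terms
   [|b_vu| f0_v g0_u (sg b_vu g_u / g0_u - f_v / f0_v)^2] sum up to
   [|g|^2 + |f|^2 - 2 f^T B g = 0], so that all of them vanish. *)
Lemma singular_pairP g f : singular_pair g f <->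
  forall v u, `|B v u| * f v 0 * g0 u 0 = B v u * g u 0 * f0 v 0.
Proof.
split=> [[Bg Bf]|bal].
  pose t v u := `|B v u| * f0 v 0 * g0 u 0 *
    (Num.sg (B v u) * (g u 0 / g0 u 0) - f v 0 / f0 v 0) ^+ 2.
  have tE v u : t v u = `|B v u| * f0 v 0 * (g u 0 ^+ 2 / g0 u 0)
      + `|B v u| * g0 u 0 * (f v 0 ^+ 2 / f0 v 0)
      - B v u * g u 0 * f v 0 - B v u * f v 0 * g u 0.
    have gu := lt0r_neq0 (g0_gt0 u); have fv := lt0r_neq0 (f0_gt0 v).
    rewrite /t; have [->|b0] := eqVneq (B v u) 0; first by rewrite normr0; ring.
    have s2 : Num.sg (B v u) ^+ 2 = 1 by rewrite sqr_sg b0.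
    have bE := numEsg (B v u).
    rewrite sqrrB exprMn s2 [X in X * _ * f v 0]bE [X in X * f v 0 * _]bE.
    by field; rewrite gu fv.
  have t_ge0 v u : 0 <= t v u.
    by rewrite mulr_ge0 ?sqr_ge0 // !mulr_ge0 ?normr_ge0 // ltW.
  have sumt : \sum_v \sum_u t v u = 0.
    under eq_bigr => v _ do under eq_bigr => u _ do rewrite tE.
    under eq_bigr => v _ do rewrite !big_split /=.
    rewrite !big_split /=.
    have -> : \sum_v \sum_u `|B v u| * f0 v 0 * (g u 0 ^+ 2 / g0 u 0)
        = \sum_u g u 0 ^+ 2.
      rewrite exchange_big /=; apply: eq_bigr => u _.
      by rewrite -mulr_suml Bf0E mulrC divfK // lt0r_neq0.
    have -> : \sum_v \sum_u `|B v u| * g0 u 0 * (f v 0 ^+ 2 / f0 v 0)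
        = \sum_v f v 0 ^+ 2.
      apply: eq_bigr => v _.
      by rewrite -mulr_suml Bg0E mulrC divfK // lt0r_neq0.
    have -> : \sum_v \sum_u - (B v u * g u 0 * f v 0) = - \sum_v f v 0 ^+ 2.
      rewrite -sumrN; apply: eq_bigr => v _; rewrite sumrN -mulr_suml expr2.
      by congr (- (_ * _)); rewrite -{1}Bg mxE.
    have -> : \sum_v \sum_u - (B v u * f v 0 * g u 0) = - \sum_u g u 0 ^+ 2.
      rewrite exchange_big -sumrN /=; apply: eq_bigr => u _.
      rewrite sumrN -mulr_suml expr2; congr (- (_ * _)).
      by rewrite -{1}Bf mxE; apply: eq_bigr => v _; rewrite mxE.
    by rewrite addrK subrr.
  move=> v u.
  have t0 : t v u = 0.
    have := psumr_eq0P (fun v _ => sumr_ge0 _ (fun u _ => t_ge0 v u)) sumt.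
    move=> /(_ v isT) /psumr_eq0P; apply=> // {}u _; exact: t_ge0.
  have [->|b0] := eqVneq (B v u) 0; first by rewrite normr0 !mul0r.
  have gu := lt0r_neq0 (g0_gt0 u); have fv := lt0r_neq0 (f0_gt0 v).
  move/eqP: t0; rewrite /t !mulf_eq0 normr_eq0 (negPf b0) (negPf gu) (negPf fv).
  rewrite /= orbb subr_eq0 => /eqP e.
  have -> : f v 0 = Num.sg (B v u) * (g u 0 / g0 u 0) * f0 v 0.
    by rewrite e divfK.
  by rewrite [X in X * g u 0](numEsg (B v u)); field.
(* Multiplying by the sign of [B v u] moves the absolute value to the other side. Summing [bal] over
   [u] against [Bg0E], and [bal'] over [v] against [Bf0E], returns the two singular equations. *)
have bal' v u : B v u * f v 0 * g0 u 0 = `|B v u| * g u 0 * f0 v 0.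
  have := bal v u; case: (sgrP (B v u)) => [->|_|_].
  - by rewrite !mul0r.
  - by [].
  - by rewrite !mulNr => <-; rewrite opprK.
split; apply/matrixP => i j; rewrite !ord1 mxE.
  apply: (mulIf (lt0r_neq0 (f0_gt0 i))).
  rewrite mulr_suml -{2}Bg0E mulr_sumr; apply: eq_bigr => u _.
  by rewrite -bal; ring.
apply: (mulIf (lt0r_neq0 (g0_gt0 i))).
rewrite mulr_suml -{2}Bf0E mulr_sumr; apply: eq_bigr => v _.
by rewrite mxE bal'; ring.
Qed.

(** Connectedness of the bipartite graph of the nonzero entries, as an induction principle on
    columns. Rows follow, since [f0 > 0] gives each row a nonzero entry. *)
Hypothesis B_connected : forall S : pred 'I_n, (exists u, S u) ->
  (forall v u u', B v u != 0 -> B v u' != 0 -> S u -> S u') -> forall u, S u.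

(** Across a nonzero entry the balance relation makes [g u] and [f v] vanish together, so the
    support of [g] is stable under sharing a row and connectedness makes it everything. *)
Lemma singular_pair_neq0 g f : singular_pair g f -> g != 0 ->
  (forall u, g u 0 != 0) /\ (forall v, f v 0 != 0).
Proof.
move=> /singular_pairP bal g_neq0.
have edge v u : B v u != 0 -> (f v 0 == 0) = (g u 0 == 0).
  move=> b0; have /eqP := bal v u.
  have gu := lt0r_neq0 (g0_gt0 u); have fv := lt0r_neq0 (f0_gt0 v).
  have [->|f_n] := eqVneq (f v 0) 0.
    rewrite mulr0 mul0r eq_sym !mulf_eq0 (negPf b0) (negPf fv) orbF /=.
    by move=> ->.
  have [->|//] := eqVneq (g u 0) 0.
  by rewrite mulr0 mul0r !mulf_eq0 normr_eq0 (negPf b0) (negPf gu) (negPf f_n).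
have gn0 u : g u 0 != 0.
  apply: (B_connected (S := fun u => g u 0 != 0)) => [|v a b /edge va /edge vb].
    apply: contrapT => no; move/eqP: g_neq0; apply.
    apply/matrixP => i j; rewrite ord1 mxE; apply/eqP.
    by apply: contrapT => /negP gi; apply: no; exists i.
  by rewrite -va vb.
split=> // v; have [u vu|no] := pickP (fun u => B v u != 0).
  by rewrite (edge v u vu).
have := f0_gt0 v; rewrite -Bg0E big1 ?ltxx // => u _.
by move/negbFE/eqP: (no u) => ->; rewrite normr0 mul0r.
Qed.

(** Subtracting the multiple that cancels one coordinate leaves a singular pair with a zero entry,
    whose first component is then zero. *)
Lemma singular_pair_uniq g f g' f' : singular_pair g f -> g != 0 ->
  singular_pair g' f' -> exists c, g' = c *: g /\ f' = c *: f.
Proof.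
move=> gf g_neq0 [Bg' Bf'].
have [gn0 _] := singular_pair_neq0 gf g_neq0; case: (gf) => Bg Bf.
have [u _|no] := pickP 'I_n; last first.
  by case/eqP: g_neq0; apply/matrixP => u; have := no u.
pose c := g' u 0 / g u 0; exists c.
have cg : singular_pair (g' - c *: g) (f' - c *: f).
  by split; rewrite mulmxBr -scalemxAr ?Bg ?Bg' ?Bf ?Bf'.
have g'E : g' = c *: g.
  apply/eqP; rewrite -subr_eq0; apply/negPn/negP.
  move=> /(singular_pair_neq0 cg)[/(_ u)/negP[]].
  by rewrite !mxE divfK // subrr.
by split=> //; rewrite -Bg' g'E -scalemxAr Bg.
Qed.

(** With [cogram_eigenP], this makes the eigenvectors for -1 of the two Gram matrices the two halves
    of the same singular pairs, so that both operators are studied at once. *)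
Lemma gram_eigenP g : - (B^T *m B) *m g = -1 *: g <-> singular_pair g (B *m g).
Proof.
rewrite mulNmx scaleN1r -mulmxA /singular_pair.
by split=> [/oppr_inj|[_ ->]].
Qed.

Lemma cogram_eigenP f : - (B *m B^T) *m f = -1 *: f <-> singular_pair (B^T *m f) f.
Proof.
rewrite mulNmx scaleN1r -mulmxA /singular_pair.
by split=> [/oppr_inj|[-> _]].
Qed.

Lemma gram_sym : (- (B^T *m B))^T = - (B^T *m B).
Proof. by rewrite linearN /= trmx_mul trmxK. Qed.

Lemma cogram_sym : (- (B *m B^T))^T = - (B *m B^T).
Proof. by rewrite linearN /= trmx_mul trmxK. Qed.

Lemma singular_pair_neq0C g f : singular_pair g f -> (f != 0) = (g != 0).
Proof.
move=> [Bg Bf]; congr (~~ _); apply/eqP/eqP => [f_0|g_0].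
  by rewrite -Bf f_0 mulmx0.
by rewrite -Bg g_0 mulmx0.
Qed.

Lemma gram_eigenvalue : eigenvalue (- (B^T *m B)) (-1) <->
  exists g f, singular_pair g f /\ g != 0.
Proof.
rewrite eigenvalue_sym ?gram_sym //; split=> [[g gn0 /gram_eigenP gf]|].
  by exists g, (B *m g).
move=> [g [f [gf gn0]]]; exists g => //; apply/gram_eigenP.
by case: (gf) => -> _.
Qed.

Lemma cogram_eigenvalue : eigenvalue (- (B *m B^T)) (-1) <->
  exists g f, singular_pair g f /\ g != 0.
Proof.
rewrite eigenvalue_sym ?cogram_sym //; split=> [[f fn0 /cogram_eigenP gf]|].
  by exists (B^T *m f), f; rewrite -(singular_pair_neq0C gf).
move=> [g [f [gf gn0]]]; exists f; first by rewrite (singular_pair_neq0C gf).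
by apply/cogram_eigenP; case: (gf) => _ ->.
Qed.

Lemma gram_multiplicity_one g f : singular_pair g f -> g != 0 ->
  multiplicity_one (- (B^T *m B)) (-1).
Proof.
move=> gf gn0; apply: (multiplicity_one_sym (g := g)) => //.
- exact: gram_sym.
- by apply/gram_eigenP; case: (gf) => -> _.
by move=> w /gram_eigenP/(singular_pair_uniq gf gn0)[c [-> _]]; exists c.
Qed.

Lemma cogram_multiplicity_one g f : singular_pair g f -> g != 0 ->
  multiplicity_one (- (B *m B^T)) (-1).
Proof.
move=> gf gn0; apply: (multiplicity_one_sym (g := f)) => //.
- exact: cogram_sym.
- by rewrite (singular_pair_neq0C gf).
- by apply/cogram_eigenP; case: (gf) => _ ->.
by move=> w /cogram_eigenP/(singular_pair_uniq gf gn0)[c [_ ->]]; exists c.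
Qed.

Lemma gram_eigenvectorP g f : singular_pair g f -> g != 0 ->
  forall g', eigenvector (- (B^T *m B)) (-1) g' <->
    exists2 c, c != 0 & g' = c *: g.
Proof.
move=> gf gn0 g'; split=> [[g'n0 /gram_eigenP/(singular_pair_uniq gf gn0)]|].
  move=> [c [g'E _]]; exists c => //; move: g'n0; rewrite g'E.
  by apply: contraNneq => ->; rewrite scale0r.
move=> [c c0 ->]; split; first by rewrite scaler_eq0 negb_or c0.
by apply/gram_eigenP; case: gf => Bg Bf; split; rewrite // -!scalemxAr Bg Bf.
Qed.

Lemma cogram_eigenvectorP g f : singular_pair g f -> g != 0 ->
  forall f', eigenvector (- (B *m B^T)) (-1) f' <->
    exists2 c, c != 0 & f' = c *: f.
Proof.
move=> gf gn0 f'; have fn0 : f != 0 by rewrite (singular_pair_neq0C gf).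
split=> [[f'n0 /cogram_eigenP/(singular_pair_uniq gf gn0)]|].
  move=> [c [_ f'E]]; exists c => //; move: f'n0; rewrite f'E.
  by apply: contraNneq => ->; rewrite scale0r.
move=> [c c0 ->]; split; first by rewrite scaler_eq0 negb_or c0.
by apply/cogram_eigenP; case: gf => Bg Bf; split; rewrite // -!scalemxAr Bf Bg.
Qed.

End SingularPairs.

(** * Nodes and components *)

Section Nodes.
Variable G : doubleCover.
Implicit Types (u v : G) (a b c : qnode G) (O : qnode G -> G).

Lemma cls_neg u : cls (neg u) = cls u.
Proof. by apply: val_inj; rewrite /= negK setUC. Qed.

Lemma mem_fiber a u : (u \in fiber a) = (cls u == a).
Proof.
have [w ->] := cls_surj a; rewrite !inE; apply/orP/eqP => [[/eqP->|/eqP->]|] //.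
  exact: cls_neg.
by move=> /(congr1 (@fiber G))/setP/(_ u); rewrite !inE eqxx => /esym/orP.
Qed.

Lemma cls_orient O a : orientation O -> cls (O a) = a.
Proof. by move=> /(_ a); rewrite mem_fiber => /eqP. Qed.

Lemma cls_inj u v : cls u = cls v -> u = v \/ u = neg v.
Proof.
move=> /eqP; rewrite -mem_fiber !inE => /orP[]/eqP->; first by left.
by right.
Qed.

Lemma orient_inj O : orientation O -> injective O.
Proof. by move=> Oo a b e; rewrite -(cls_orient a Oo) e cls_orient. Qed.

(** Under strong grading, a shared neighbour of two nodes fixes their layers, so adjacency can be
    read off from the shared neighbour alone. *)
Lemma qsub_layer k a b : strong_grading G -> qsub a b ->
  (b \in qlayer G k) = (a \in qlayer G (k - 1)).
Proof.
move=> strong; have [[u ->] [v ->]] := (cls_surj a, cls_surj b).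
by rewrite qsub_cls => /strong dv; rewrite !in_qlayer_cls dv [RHS]eq_sym subr_eq eq_sym.
Qed.

Lemma LP_gt0 a : (0 < LP a)%N.
Proof.
have [u ->] := cls_surj a => {a}.
(* The number of nodes of larger dimension strictly decreases along an edge and serves as the
   induction measure. *)
have [n] := ssrnat.ubnP #|[set v : G | Defs.dim u < Defs.dim v]|; elim: n u => // n IH u un.
rewrite LPE; case: ifPn => //; rewrite negbK => /existsP[b ub].
have [v bE] := cls_surj b; rewrite (bigD1 b) //= addn_gt0; apply/orP; left.
rewrite bE; apply: IH; rewrite ltnS in un; apply: leq_trans un.
apply: proper_card.
move: ub; rewrite bE qsub_cls => /sub_dim uv; apply/properP; split.
  by apply/subsetP => x; rewrite !inE; apply: lt_trans.
by exists v; rewrite !inE ?ltxx.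
Qed.

Lemma RP_gt0 a : (0 < RP a)%N.
Proof.
have [u ->] := cls_surj a => {a}.
have [n] := ssrnat.ubnP #|[set v : G | Defs.dim v < Defs.dim u]|; elim: n u => // n IH u un.
rewrite RPE; case: ifPn => //; rewrite negbK => /existsP[b ub].
have [v bE] := cls_surj b; rewrite (bigD1 b) //= addn_gt0; apply/orP; left.
rewrite bE; apply: IH; rewrite ltnS in un; apply: leq_trans un.
apply: proper_card.
move: ub; rewrite bE qsub_cls => /sub_dim uv; apply/properP; split.
  by apply/subsetP => x; rewrite !inE => xv; apply: lt_trans uv.
by exists v; rewrite !inE ?ltxx.
Qed.

End Nodes.

(** * Connected components of a symmetric adjacency *)

Section Components.
Variables (G : doubleCover) (e : rel (qnode G)) (k : int).
Hypothesis e_sym : symmetric e.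
Hypothesis e_layer : forall a b, e a b -> b \in qlayer G k.
Implicit Types C D : {set qnode G}.

Let r C := [rel x y | [&& x \in C, y \in C & e x y]].

Let r_sym C : connect_sym (r C).
Proof. by apply: sym_connect_sym => x y /=; rewrite e_sym andbCA. Qed.

Lemma connected_in_ind C : connected_in e k C -> forall Q : pred (qnode G),
    (exists2 a, a \in C & Q a) ->
    (forall a b, a \in C -> b \in C -> e a b -> Q a -> Q b) ->
  forall a, a \in C -> Q a.
Proof.
move=> /and3P[_ _ /forall_inP conn] Q [a aC Qa] step b bC.
have /forall_inP/(_ b bC) ab := conn a aC.
have QP : closed (r C) Q.
  by apply: (intro_closed (r_sym C)) => x y /and3P[xC yC xy]; apply: step.
by have := closed_connect QP ab; rewrite !unfold_in Qa => <-.
Qed.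

(** Adding to [C] a neighbour [b] of [a] keeps it connected, every node still reaching [a];
    maximality then puts [b] in [C]. *)
Lemma component_closed C : maxset (connected_in e k) C ->
  forall a b, a \in C -> e a b -> b \in C.
Proof.
move=> /maxsetP[/and3P[C0 Ck /forall_inP conn] maxC] a b aC ab.
suff bC : connected_in e k (b |: C).
  by rewrite -(maxC _ bC) ?subsetUr // setU11.
have toa x : x \in b |: C -> connect (r (b |: C)) x a.
  case/setU1P => [->|xC].
    by apply: connect1; rewrite /= setU11 setU1r // e_sym.
  have /forall_inP/(_ a aC) := conn x xC; apply: connect_sub => y z.
  by move=> /and3P[yC zC yz]; apply: connect1; rewrite /= !setU1r.
apply/and3P; split.
- by apply/set0Pn; exists b; rewrite setU11.
- by rewrite subUset sub1set (e_layer ab).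
apply/forall_inP => x /toa xa; apply/forall_inP => y /toa ya.
by apply: connect_trans xa _; rewrite r_sym.
Qed.

Lemma closed_component D : connected_in e k D ->
  (forall a b, a \in D -> e a b -> b \in D) -> maxset (connected_in e k) D.
Proof.
move=> Dc Dcl; apply/maxsetP; split=> // E Ec DE; apply/eqP.
rewrite eqEsubset DE andbT; apply/subsetP.
apply: (connected_in_ind Ec) => [|a b _ _ ab aD]; last exact: Dcl ab.
have /and3P[/set0Pn[d dD] _ _] := Dc.
by exists d => //; apply: (subsetP DE).
Qed.

End Components.

(* Both the pair [sub], [sgn] and its reversal are signed incidences, so that
   every lemma on them has an up- and a down-version. *)
Record signed_incidence (G : doubleCover) (inc : rel G) (s : G -> G -> int)
    (q : rel (qnode G)) : Prop := SignedIncidence {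
  q_cls : forall u v, q (cls u) (cls v) = inc u v;
  s_pm1 : forall u v, inc u v -> s u v = 1 \/ s u v = -1;
  s_negl : forall u v, inc u v -> s (neg u) v = - s u v;
  s_negr : forall u v, inc u v -> s u (neg v) = - s u v
}.

Lemma up_incidence (G : doubleCover) :
  signed_incidence (@sub G) (fun u v => sgn v u) (@qsub G).
Proof.
by split=> u v; [apply: qsub_cls|apply: sgnP|apply: sgn_negr|apply: sgn_negl].
Qed.

Lemma down_incidence (G : doubleCover) :
  signed_incidence (fun u v : G => sub v u) sgn (fun a b => qsub b a).
Proof.
by split=> u v; [apply: qsub_cls|apply: sgnP|apply: sgn_negl|apply: sgn_negr].
Qed.

(** * Signed incidences and coherence as a sign factorization *)

Section Incidence.
Variables (G : doubleCover) (inc : rel G) (s : G -> G -> int).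
Variable q : rel (qnode G).
Hypothesis I : signed_incidence inc s q.
Implicit Types (u v x y : G) (a b c : qnode G) (C D : {set qnode G})
  (O : qnode G -> G).

Definition coherent_for C (O : qnode G -> G) :=
  forall u u' v, u \in O @: C -> u' \in O @: C -> inc u v -> inc u' v ->
    s u v = s u' v.

(** Connectedness through shared neighbours, in the form of an induction principle that serves both
    the walks and the operators. *)
Definition q_linked C := forall Q : pred (qnode G),
  (exists2 a, a \in C & Q a) ->
  (forall a b c, a \in C -> b \in C -> q a c -> q b c -> Q a -> Q b) ->
  forall a, a \in C -> Q a.

Definition q_closed C := forall a b c, a \in C -> q a c -> q b c -> b \in C.

Lemma inc_negl u v : inc (neg u) v = inc u v.
Proof. by rewrite -!(q_cls I) cls_neg. Qed.

Lemma inc_negr u v : inc u (neg v) = inc u v.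
Proof. by rewrite -!(q_cls I) cls_neg. Qed.

Lemma s_signE u v : inc u v -> s u v = (-1) ^+ (s u v == -1).
Proof. by move=> /(s_pm1 I)[]->. Qed.

Lemma s_neq u u' v : inc u v -> inc u' v -> s u v <> s u' v -> s u v = - s u' v.
Proof. by move=> /(s_pm1 I)[]-> /(s_pm1 I)[]->. Qed.

(* Reversing the middle node exchanges the two signs. *)
Lemma opposite_signsP x y :
  (exists v, [/\ inc x v, inc y v & s x v = - s y v]) <->
  exists v, [&& inc x v, inc y v, s x v == 1 & s y v == -1].
Proof.
split=> [[v [xv yv e]]|[v /and4P[xv yv /eqP e1 /eqP e2]]]; last first.
  by exists v; split=> //; rewrite e1 e2 opprK.
have [x1|x1] := s_pm1 I xv; [exists v|exists (neg v)].
  by rewrite xv yv x1 -[s y v]opprK -e x1 !eqxx.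
rewrite !inc_negr xv yv (s_negr I xv) (s_negr I yv) x1.
by rewrite -e x1.
Qed.

Lemma s_clsl x y v : cls x = cls y -> inc x v ->
  s y v = (-1) ^+ (y != x) * s x v.
Proof.
move=> /esym/cls_inj[->|->] xv; first by rewrite eqxx expr0 mul1r.
by rewrite neg_neq (s_negl I xv) expr1 mulN1r.
Qed.

Lemma s_clsr x y u : cls x = cls y -> inc u x ->
  s u y = (-1) ^+ (y != x) * s u x.
Proof.
move=> /esym/cls_inj[->|->] ux; first by rewrite eqxx expr0 mul1r.
by rewrite neg_neq (s_negr I ux) expr1 mulN1r.
Qed.

(** Relative to the fixed orientation [O], [eps] records where a coherent [O'] differs from [O], and
    [del] the common sign that [O b] then sees. The factorization is symmetric in [C] and [D], which
    links up- and down-coherence. *)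
Lemma coherent_balanced C D O : orientation O ->
    (forall a b, a \in C -> q a b -> b \in D) ->
  (exists2 O', orientation O' & coherent_for C O') <->
  exists eps del : qnode G -> bool, forall a b, a \in C -> b \in D -> q a b ->
    s (O a) (O b) = (-1) ^+ eps a * (-1) ^+ del b.
Proof.
move=> Oo CD; have qO a b : q a b = inc (O a) (O b).
  by rewrite -(q_cls I) !cls_orient.
split=> [[O' O'o coh]|[eps [del bal]]].
  have incO' a b : q a b -> inc (O' a) (O b).
    by rewrite -(q_cls I) !cls_orient.
  (* Coherence makes this sign independent of the neighbour picked; the default is taken only at a
     [b] without neighbour in [C]. *)
  pose del b := if [pick a | (a \in C) && q a b] is Some a
                then s (O' a) (O b) == -1 else false.
  exists (fun a => O' a != O a), del => a b aC bD ab.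
  rewrite /del; case: pickP => [a' /andP[a'C a'b]|/(_ a)]; last by rewrite aC ab.
  rewrite -s_signE ?incO' // -(coh (O' a) (O' a') (O b)) ?incO' ?imset_f //.
  rewrite (@s_clsl (O a) (O' a)) ?cls_orient -?qO //.
  by rewrite mulrA -expr2 sqrr_sign mul1r.
(* Reversing the nodes marked by [eps] cancels the factor depending on [a], leaving a sign that
   depends on [v] only. *)
pose O' a := if eps a then neg (O a) else O a.
have O'o : orientation O'.
  move=> a; rewrite mem_fiber /O'; case: ifP; rewrite ?cls_neg cls_orient //.
exists O' => //.
have O'E a v : a \in C -> inc (O' a) v ->
    s (O' a) v = (-1) ^+ del (cls v) * (-1) ^+ (v != O (cls v)).
  move=> aC; have -> : inc (O' a) v = inc (O a) v.
    by rewrite /O'; case: ifP; rewrite ?inc_negl.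
  move=> av; have qav : q a (cls v) by rewrite -(cls_orient a Oo) (q_cls I).
  have -> : s (O' a) v = (-1) ^+ eps a * s (O a) v.
    rewrite /O'; case: (eps a); first by rewrite (s_negl I av) expr1 mulN1r.
    by rewrite expr0 mul1r.
  have sb := bal a (cls v) aC (CD _ _ aC qav) qav.
  have aO : inc (O a) (O (cls v)) by rewrite -qO.
  rewrite (@s_clsr (O (cls v)) v) ?cls_orient //.
  by rewrite sb mulrCA [X in _ * X]mulrA -expr2 sqrr_sign mul1r mulrC.
move=> u u' v /imsetP[a aC ->] /imsetP[a' a'C ->] av a'v.
by rewrite !O'E.
Qed.

End Incidence.

(** * Random walks: positivity of the n-step probabilities and the period *)

Section Walks.
Variables (R : realType) (T : finType) (S : {set T}) (P : T -> T -> R).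
Hypothesis P_ge0 : forall x y, 0 <= P x y.

Lemma nstep_ge0 n x y : 0 <= nstep S P n x y.
Proof.
elim: n x => [|n IH] x /=; first by rewrite ler0n.
by apply: sumr_ge0 => z _; apply: mulr_ge0.
Qed.

(** Nonnegative terms cannot cancel, so a positive n-step probability amounts to a path of n
    positive steps. *)
Lemma nstepS_gt0 n x y : 0 < nstep S P n.+1 x y <->
  exists z, [/\ z \in S, 0 < P x z & 0 < nstep S P n z y].
Proof.
have ge0 z : z \in S -> 0 <= P x z * nstep S P n z y.
  by move=> _; rewrite mulr_ge0 // nstep_ge0.
have pos z : (0 < P x z * nstep S P n z y) = (0 < P x z) && (0 < nstep S P n z y).
  rewrite !lt0r mulf_eq0 negb_or P_ge0 nstep_ge0 mulr_ge0 ?nstep_ge0 //.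
  by rewrite !andbT.
rewrite lt0r sumr_ge0 // andbT psumr_neq0 //; split.
  by case/hasP => z _ /andP[zS]; rewrite pos => /andP[]; exists z.
case=> z [zS xz zy]; apply/hasP; exists z; rewrite ?mem_index_enum //.
by rewrite zS pos xz.
Qed.

Lemma nstep_trans n m x y z :
  0 < nstep S P n x y -> 0 < nstep S P m y z -> 0 < nstep S P (n + m) x z.
Proof.
elim: n x => [|n IH] x.
  by rewrite /= ltr0n; case: eqP => // ->.
move=> /nstepS_gt0[w [wS xw wy]] yz; rewrite addSn; apply/nstepS_gt0.
by exists w; split=> //; apply: IH.
Qed.

End Walks.

Section AperiodicWalks.
Variables (R : realType) (G : doubleCover) (inc : rel G) (s : G -> G -> int).
Variable q : rel (qnode G).
Hypothesis I : signed_incidence inc s q.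
Variables (S : {set G}) (P : G -> G -> R) (C : {set qnode G}).
Hypothesis C_neq0 : C != set0.
Hypothesis C_linked : q_linked q C.
Hypothesis C_closed : q_closed q C.
Hypothesis C_inc : forall a, a \in C -> exists c, q a c.
Hypothesis CS : lift_set C \subset S.
Hypothesis P_ge0 : forall x y, 0 <= P x y.
Hypothesis P_gt0 : forall x y, cls x \in C -> (0 < P x y) <->
  exists v, [/\ inc x v, inc y v & s x v = - s y v].

Let e : rel G := [rel x y | [exists v, [&& inc x v, inc y v & s x v == - s y v]]].

Let eP x y : reflect (exists v, [/\ inc x v, inc y v & s x v = - s y v]) (e x y).
Proof.
apply: (iffP existsP) => -[v]; first by case/and3P => ? ? /eqP; exists v.
by case=> xv yv xyv; exists v; rewrite xv yv xyv eqxx.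
Qed.

Let e_sym : symmetric e.
Proof.
suff h x y : e x y -> e y x by move=> x y; apply/idP/idP; apply: h.
by move=> /eP[v [xv yv xyv]]; apply/eP; exists v; rewrite xyv opprK.
Qed.

Let e_closed x y : cls x \in C -> e x y -> cls y \in C.
Proof.
move=> xC /eP[v [xv yv _]]; apply: (C_closed (c := cls v) xC);
  by rewrite (q_cls I).
Qed.

Let e_neg x : cls x \in C -> e x (neg x).
Proof.
move=> xC; have [c xc] := C_inc xC; have [v cv] := cls_surj c.
move: xc; rewrite cv (q_cls I) => xv; apply/eP; exists v.
by rewrite (inc_negl I) (s_negl I xv) opprK.
Qed.

Let e_step n x y z : cls x \in C -> e x y -> 0 < nstep S P n y z ->
  0 < nstep S P n.+1 x z.
Proof.
move=> xC xy yz; apply/nstepS_gt0 => //; exists y; split=> //.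
  by apply: (subsetP CS); rewrite inE (e_closed xC).
by apply/P_gt0 => //; apply/eP.
Qed.

(** Double steps of the support graph [e]: the [e2]-class of a node is the candidate for one side of
    a bipartition. *)
Let e2 : rel G := [rel x y | [exists z, e x z && e z y]].

Let e2_sym : connect_sym e2.
Proof.
apply: sym_connect_sym => x y; apply/existsP/existsP => -[z /andP[xz zy]];
  by exists z; rewrite e_sym zy e_sym.
Qed.

Let e2_walk x y : cls x \in C -> connect e2 x y ->
  cls y \in C /\ exists2 n, ~~ odd n & 0 < nstep S P n x y.
Proof.
move=> xC /connectP[p + ->]; elim: p x xC => [|z p IH] x xC /=.
  by move=> _; split=> //; exists 0%N; rewrite //= eqxx ltr01.
move=> /andP[/existsP[w /andP[xw wz]]].
have wC := e_closed xC xw; have zC := e_closed wC wz.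
move=> /(IH _ zC)[yC [n n2 zy]]; split=> //; exists n.+2; first by rewrite /= negbK.
by apply: (e_step xC xw); apply: (e_step wC wz).
Qed.

(** A coherent orientation is a 2-colouring, so all return times are even. Conversely, returns of
    length 2 exist, so either an odd closed walk forces period 1, or the nodes reached from [x] by
    double steps form one side of a bipartition, which is a coherent orientation. *)
Lemma not_aperiodicP (O : qnode G -> G) : orientation O ->
  ~ aperiodic_on S P (lift_set C) <->
  exists2 O', orientation O' & coherent_for inc s C O'.
Proof.
move=> Oo; split=> [|[O' O'o coh] aper]; last first.
  pose side x := O' (cls x) == x.
  have e_side x y : cls x \in C -> e x y -> side y = ~~ side x.
    move=> xC xy; have yC := e_closed xC xy; have /eP[v [xv yv xyv]] := xy.
    have := coh (O' (cls x)) (O' (cls y)) v (imset_f _ xC) (imset_f _ yC).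
    rewrite -!(q_cls I) !cls_orient // !(q_cls I) => /(_ xv yv).
    rewrite (s_clsl I (x := x) (y := O' (cls x))) ?cls_orient //.
    rewrite (s_clsl I (x := y) (y := O' (cls y))) ?cls_orient //.
    rewrite /side xyv; case: (s_pm1 I yv) => ->;
      by case: (O' (cls x) == x); case: (O' (cls y) == y).
  have walk_side n x y : cls x \in C -> 0 < nstep S P n x y ->
      side y = odd n (+) side x.
    elim: n x => [|n IH] x xC; first by rewrite /= ltr0n; case: eqP => // ->.
    move=> /nstepS_gt0[] // z [_ /P_gt0-/(_ xC)/eP xz zy].
    by rewrite (IH z (e_closed xC xz) zy) (e_side x z) //= addNb addbN.
  have /set0Pn[a aC] := C_neq0; have [x ax] := cls_surj a.
  rewrite ax in aC; have xL : x \in lift_set C by rewrite inE.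
  (* Period 1 forces every common divisor of the return times to divide 1, whereas 2 is one of them
     by parity. *)
  have [_ even] := aper x xL 2%N; suff : (2 %| 1)%N by [].
  apply: even => n _ /(walk_side _ _ _ aC); rewrite dvdn2.
  by case: (odd n); case: (side x).
move=> nap; apply: contrapT => incoh; apply: nap => x; rewrite inE => xC e0.
split=> [|ret]; first by rewrite dvdn1 => /eqP->.
(* The closed walk from [x] to [neg x] and back has length 2. *)
have e02 : (e0 %| 2)%N.
  apply: ret => //; apply: (e_step xC (e_neg xC)).
  have nxC : cls (neg x) \in C by rewrite cls_neg.
  apply: (e_step nxC (y := x)); first by rewrite e_sym e_neg.
  by rewrite /= eqxx ltr01.
(* A step between two nodes at even distance from [x] closes up to an odd return, coprime to 2.
   Without such a step, the nodes at even distance give the orientation. *)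
have [/existsP[u /existsP[u' /and3P[xu xu' uu']]]|none] :=
  boolP [exists u, exists u', [&& connect e2 x u, connect e2 x u' & e u u']].
  have [uC [n n2 xun]] := e2_walk xC xu.
  have [u'C _] := e2_walk xC xu'; rewrite e2_sym in xu'.
  have [_ [m m2 u'xm]] := e2_walk u'C xu'.
  have /ret e0n : 0 < nstep S P (n + m.+1) x x.
    by apply: nstep_trans xun _ => //; apply: e_step uu' u'xm.
  rewrite -(eqP (_ : coprime 2 (n + m.+1))) ?dvdn_gcd ?e02 ?e0n ?addnS //.
  by rewrite coprime2n /= oddD (negPf n2) (negPf m2).
case: incoh.
pose O' a := odflt (O a) [pick u in fiber a | connect e2 x u].
have O'o : orientation O'.
  by move=> a; rewrite /O'; case: pickP => [u /andP[]|_] //=; apply: Oo.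
have O'C a : a \in C -> connect e2 x (O' a).
  move=> aC; suff : [exists u in fiber a, connect e2 x u].
    rewrite /O'; case: pickP => [u /andP[]|no /exists_inP[u ua]] //=.
    by have := no u; rewrite ua /= => ->.
  move: a aC; apply: C_linked => [|a b c aC bC ac bc /exists_inP[u]].
    by exists (cls x) => //; apply/exists_inP; exists x; rewrite ?mem_fiber ?connect0.
  rewrite mem_fiber => /eqP uE xu.
  have [[w bE] [v cE]] := (cls_surj b, cls_surj c).
  move: ac bc aC bC; rewrite -uE bE cE !(q_cls I) => uv wv uC wC.
  have unu : e u (neg u) by apply: e_neg.
  (* To change fibre in an even number of steps, pass from [u] to [neg u], then to [w] or [neg w],
     whichever has the sign opposite to that of [neg u] at [v]. *)
  have via x' : cls x' = cls w -> e (neg u) x' ->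
      [exists z in fiber (cls w), connect e2 x z].
    move=> x'w nux'; apply/exists_inP; exists x'; first by rewrite mem_fiber x'w.
    apply: connect_trans xu (connect1 _); apply/existsP; exists (neg u).
    by rewrite unu.
  have [uw|uw] := eqVneq (s u v) (s w v).
    apply: (via w) => //; apply/eP; exists v.
    by rewrite (inc_negl I) (s_negl I uv) uw.
  apply: (via (neg w)); first exact: cls_neg.
  apply/eP; exists v; rewrite !(inc_negl I) (s_negl I uv) (s_negl I wv).
  by rewrite (s_neq I uv wv) //; apply/eqP.
exists O' => // u u' v /imsetP[a aC ->] /imsetP[a' a'C ->] av a'v.
(* Different signs at [v] would be a step between two nodes at even distance, excluded by [none]. *)
apply/eqP/negPn/negP => /eqP/(s_neq I av a'v) opp.
case/existsP: none; exists (O' a); apply/existsP; exists (O' a').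
by rewrite !O'C //=; apply/eP; exists v.
Qed.

End AperiodicWalks.

(** * The up- and down-operators *)

Lemma psum_gt0P (R : realDomainType) (J : finType) (P : pred J) (F : J -> R) :
  (forall i, P i -> 0 < F i) -> 0 < \sum_(i | P i) F i <-> exists i, P i.
Proof.
move=> pos; have ge0 i : P i -> 0 <= F i by move=> /pos/ltW.
rewrite lt0r sumr_ge0 // andbT psumr_neq0 //; split.
  by case/hasP => i _ /andP[Pi _]; exists i.
by case=> i Pi; apply/hasP; exists i; rewrite ?mem_index_enum //= Pi pos.
Qed.

Section Weights.
Variables (R : realType) (G : doubleCover).
Implicit Types (a b : qnode G) (u v : G) (C : {set qnode G}).

Lemma LPR_gt0 a : 0 < LPR R a.
Proof. by rewrite ltr0n LP_gt0. Qed.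

Lemma RPR_gt0 a : 0 < RPR R a.
Proof. by rewrite ltr0n RP_gt0. Qed.

Lemma Hratio_gt0 a : 0 < Hratio R a.
Proof. by rewrite divr_gt0 ?LPR_gt0 ?RPR_gt0. Qed.

Lemma sqrtLR_gt0 u : 0 < sqrtLR (R := R) u.
Proof. by rewrite sqrtr_gt0 mulr_gt0 ?LPR_gt0 ?RPR_gt0. Qed.

(** With [sqrtLR_sqrtH], this turns the singular equations of [sqrtLR] into the recursions for [LP]
    and [RP]. *)
Lemma sqrtH_sqrtLR u :
  Num.sqrt (Hratio R (cls u)) * sqrtLR u = LPR R (cls u).
Proof.
have [l r] := (LPR_gt0 (cls u), RPR_gt0 (cls u)).
rewrite /sqrtLR /Hratio -sqrtrM ?divr_ge0 ?ltW //.
have -> : LPR R (cls u) / RPR R (cls u) * (LPR R (cls u) * RPR R (cls u))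
        = LPR R (cls u) ^+ 2 by field; rewrite lt0r_neq0.
by rewrite sqrtr_sqr gtr0_norm.
Qed.

Lemma sqrtLR_sqrtH u :
  sqrtLR u / Num.sqrt (Hratio R (cls u)) = RPR R (cls u).
Proof.
have [l r h] := And3 (LPR_gt0 (cls u)) (RPR_gt0 (cls u)) (Hratio_gt0 (cls u)).
have hn : Num.sqrt (Hratio R (cls u)) != 0 by rewrite gt_eqF // sqrtr_gt0.
apply: (mulIf hn); rewrite divfK //; apply: (mulfI hn).
rewrite sqrtH_sqrtLR mulrCA -expr2 sqr_sqrtr ?ltW // /Hratio.
by rewrite mulrC divfK // lt0r_neq0.
Qed.

Lemma up_walk_ge0 u u' : 0 <= up_walk (R := R) u u'.
Proof.
rewrite /up_walk; case: ifP => _; first by case: ifP; rewrite ?invr_ge0.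
by apply: sumr_ge0 => v _; rewrite divr_ge0 ?mulr_ge0 ?ler0n.
Qed.

Lemma down_walk_ge0 u u' : 0 <= down_walk (R := R) u u'.
Proof.
rewrite /down_walk; case: ifP => _; first by case: ifP; rewrite ?invr_ge0.
by apply: sumr_ge0 => v _; rewrite divr_ge0 ?mulr_ge0 ?ler0n.
Qed.

Lemma up_walk_gt0 u u' : ~~ leaf (cls u) -> 0 < up_walk (R := R) u u' <->
  exists v, [/\ sub u v, sub u' v & sgn v u = - sgn v u'].
Proof.
move=> nl; rewrite /up_walk (negPf nl) (opposite_signsP (up_incidence G)).
by apply: psum_gt0P => v _; rewrite divr_gt0 ?mulr_gt0 ?LPR_gt0 ?RPR_gt0.
Qed.

Lemma down_walk_gt0 u u' : ~~ Defs.root (cls u) ->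
  0 < down_walk (R := R) u u' <->
  exists t, [/\ sub t u, sub t u' & sgn u t = - sgn u' t].
Proof.
move=> nr; rewrite /down_walk (negPf nr) psum_gt0P; last first.
  by move=> v _; rewrite divr_gt0 ?mulr_gt0 ?LPR_gt0 ?RPR_gt0.
(* [opposite_signsP] puts the sign 1 on the first node and the down-walk puts it on the second,
   hence the exchange of [u] and [u']. *)
have flip x y : (exists t, [/\ sub t x, sub t y & sgn x t = - sgn y t]) ->
    exists t, [/\ sub t y, sub t x & sgn y t = - sgn x t].
  by case=> t [tx ty e]; exists t; rewrite e opprK.
split=> [[t /and4P[tu tu' /eqP e /eqP e']]|/flip].
  by exists t; rewrite e e'.
move/(opposite_signsP (down_incidence G)) => [t /and4P[tu' tu e' e]].
by exists t; rewrite tu tu' e e'.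
Qed.

Lemma up_adj_sym k : symmetric (@up_adj G k).
Proof.
move=> a b; rewrite /up_adj andbCA eq_sym; do 3!congr (_ && _).
by apply: eq_existsb => c; rewrite [qsub a c && _]andbC.
Qed.

Lemma down_adj_sym k : symmetric (@down_adj G k).
Proof.
move=> a b; rewrite /down_adj andbCA eq_sym; do 3!congr (_ && _).
by apply: eq_existsb => c; rewrite [qsub c a && _]andbC.
Qed.

End Weights.

(** * The up-component [C] and the down-component [D] above it *)

Section Correspondence.
Variables (R : realType) (G : doubleCover) (k : int) (C : {set qnode G}).
Hypothesis strong : strong_grading G.
Hypothesis C_comp : up_component (k - 1) C.
Hypothesis C_leaf : ~~ single_leaf C.
Let D := above k C.
Implicit Types a b c : qnode G.

Let C_conn : connected_in (@up_adj G (k - 1)) (k - 1) C.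
Proof. by case/maxsetP: C_comp. Qed.

Lemma up_component_neq0 : C != set0.
Proof. by case/and3P: C_conn. Qed.

Lemma up_component_layer a : a \in C -> a \in qlayer G (k - 1).
Proof. by case/and3P: C_conn => _ /subsetP + _; apply. Qed.

Lemma up_adj_intro a b c : a \in qlayer G (k - 1) -> a != b -> qsub a c ->
  qsub b c -> up_adj (k - 1) a b.
Proof.
move=> ak ab ac bc.
have ck : c \in qlayer G k by rewrite (qsub_layer _ strong ac).
have bk : b \in qlayer G (k - 1) by rewrite -(qsub_layer _ strong bc).
rewrite /up_adj ak bk ab; apply/exists_inP; exists c; rewrite ?subrK //.
by rewrite ac.
Qed.

Lemma down_adj_intro a b c : a \in qlayer G k -> a != b -> qsub c a ->
  qsub c b -> down_adj k a b.
Proof.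
move=> ak ab ca cb.
have ck : c \in qlayer G (k - 1) by rewrite -(qsub_layer _ strong ca).
have bk : b \in qlayer G k by rewrite (qsub_layer _ strong cb).
rewrite /down_adj ak bk ab; apply/exists_inP; exists c => //.
by rewrite ca.
Qed.

Lemma up_component_closed : q_closed (@qsub G) C.
Proof.
move=> a b c aC ac bc; have [<-//|ab] := eqVneq a b.
apply: (component_closed (@up_adj_sym G _) _ C_comp aC).
  by move=> x y /and4P[].
exact: up_adj_intro (up_component_layer aC) ab ac bc.
Qed.

Lemma up_component_linked : q_linked (@qsub G) C.
Proof.
move=> Q Q0 step; apply: (connected_in_ind (@up_adj_sym G _) C_conn Q0).
move=> a b aC bC /and4P[_ _ _ /exists_inP[c _ /andP[ac bc]]].
exact: step ac bc.
Qed.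

(** A leaf shares no upper neighbour with another node, so a component containing one is reduced to
    it, which [C_leaf] excludes. *)
Lemma up_component_inc a : a \in C -> exists c, qsub a c.
Proof.
move=> aC; apply/existsP; apply: contraNT C_leaf => nl.
apply/existsP; exists a; rewrite [leaf a]nl eqEsubset sub1set aC andbT.
apply/subsetP; apply: up_component_linked => [|x b c _ _ xc _].
  by exists a => //; rewrite /= inE.
by rewrite /= inE => /eqP xa; case/existsP: nl; exists c; rewrite -xa.
Qed.

Lemma above_intro a b : a \in C -> qsub a b -> b \in D.
Proof.
move=> aC ab; rewrite inE (qsub_layer _ strong ab) up_component_layer //=.
by apply/exists_inP; exists a.
Qed.

Lemma above_inc b : b \in D -> exists2 a, a \in C & qsub a b.
Proof. by rewrite inE => /andP[_ /exists_inP]. Qed.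

(** With [above_intro], this shows that sums over all neighbours of a node of [C] or [D] stay inside
    the other set, as the recursions for [LP] and [RP] require. *)
Lemma above_down a b : b \in D -> qsub a b -> a \in C.
Proof. by move=> /above_inc[c cC cb] ab; apply: up_component_closed cb ab. Qed.

Lemma above_layer b : b \in D -> b \in qlayer G k.
Proof. by rewrite inE => /andP[]. Qed.

Lemma above_neq0 : D != set0.
Proof.
have /set0Pn[a aC] := up_component_neq0; have [c ac] := up_component_inc aC.
by apply/set0Pn; exists c; apply: above_intro ac.
Qed.

Lemma above_closed : q_closed (fun a b => qsub b a) D.
Proof. by move=> a b c aD ca; apply: above_intro; apply: above_down ca. Qed.

Lemma above_component : down_component k D.
Proof.
apply: (closed_component (@down_adj_sym G _)); last first.
  move=> a b aD /and4P[_ _ _ /exists_inP[c _ /andP[ca cb]]].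
  exact: above_closed ca cb.
apply/and3P; split; first exact: above_neq0.
  by apply/subsetP => b /above_layer.
apply/forall_inP => d dD.
pose r x y := [&& x \in D, y \in D & down_adj k x y].
have near a b b' : a \in C -> qsub a b -> qsub a b' -> connect r b b'.
  move=> aC ab ab'; have [->|bb'] := eqVneq b b'; first exact: connect0.
  apply: connect1; rewrite /r !(above_intro aC) //=.
  exact: down_adj_intro (above_layer (above_intro aC ab)) bb' ab ab'.
have [a0 a0C a0d] := above_inc dD.
(* Connectedness passes from [C] to [D] by induction over [C]: the upper neighbours of one node are
   mutually adjacent, and two linked nodes of [C] share one. *)
have reach : forall a, a \in C -> [forall b, qsub a b ==> connect r d b].
  apply: up_component_linked => [|a a' c aC a'C ac a'c /forallP ra].
    exists a0 => //; apply/forallP => b; apply/implyP; exact: near a0C a0d.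
  apply/forallP => b; apply/implyP => a'b.
  by apply: connect_trans (implyP (ra c) ac) _; apply: near a'C a'c a'b.
by apply/forall_inP => b /above_inc[a aC ab]; apply: (implyP (forallP (reach a aC) b)).
Qed.

Lemma above_not_root b : b \in D -> ~~ Defs.root b.
Proof.
by move=> /above_inc[a _ ab]; rewrite negbK; apply/existsP; exists a.
Qed.

Lemma up_component_not_leaf a : a \in C -> ~~ leaf a.
Proof.
by move=> /up_component_inc[c ac]; rewrite negbK; apply/existsP; exists c.
Qed.

Lemma above_not_single_root : ~~ single_root D.
Proof.
apply/existsP => -[b /andP[rb /eqP Db]].
by have := @above_not_root b; rewrite Db set11 rb => /(_ isT).
Qed.

Lemma above_linked : q_linked (fun a b => qsub b a) D.
Proof.
have /maxsetP[D_conn _] := above_component.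
move=> Q Q0 step; apply: (connected_in_ind (@down_adj_sym G _) D_conn Q0).
move=> a b aD bD /and4P[_ _ _ /exists_inP[c _ /andP[ca cb]]].
exact: step ca cb.
Qed.

Lemma coherent_up_byE O : orientation O ->
  coherent_up_by (k - 1) C O <-> coherent_for sub (fun u v => sgn v u) C O.
Proof.
move=> Oo; split=> coh u u' v uO u'O; last by move=> _; apply: coh.
move=> uv u'v; apply: coh => //; rewrite inE subrK (strong uv).
case/imsetP: uO => a aC uE; have := up_component_layer aC.
by rewrite -(cls_orient a Oo) -uE in_qlayer_cls => /eqP->; rewrite subrK.
Qed.

Lemma coherent_down_byE O : orientation O ->
  coherent_down_by k D O <-> coherent_for (fun u t => sub t u) sgn D O.
Proof.
move=> Oo; split=> coh u u' v uO u'O; last by move=> _; apply: coh.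
move=> vu vu'; apply: coh => //; rewrite inE.
case/imsetP: uO => a aD uE; have := above_layer aD.
rewrite -(cls_orient a Oo) -uE in_qlayer_cls => /eqP<-.
by rewrite (strong vu) addrK.
Qed.

Lemma coherent_upE : coherent_up (k - 1) C <->
  exists2 O, orientation O & coherent_for sub (fun u v => sgn v u) C O.
Proof.
by split=> [[_ _ [O Oo /(coherent_up_byE Oo)]]|[O Oo /(coherent_up_byE Oo)]];
  [exists O|split=> //; exists O].
Qed.

Lemma coherent_downE : coherent_down k D <->
  exists2 O, orientation O & coherent_for (fun u t => sub t u) sgn D O.
Proof.
split=> [[_ _ [O Oo /(coherent_down_byE Oo)]]|[O Oo /(coherent_down_byE Oo)]].
  by exists O.
split; [exact: above_component|exact: above_not_single_root|by exists O].
Qed.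

(** * Walks, signs and operators relative to a fixed orientation *)

Variable O : qnode G -> G.
Hypothesis Oo : orientation O.

Let clsO a : cls (O a) = a. Proof. exact: cls_orient. Qed.
Let subO a b : sub (O a) (O b) = qsub a b.
Proof. by rewrite -qsub_cls !clsO. Qed.

Lemma up_walk_periodicP :
  ~ aperiodic_on (layer G (k - 1)) (up_walk (R := R)) (lift_set C) <->
  exists2 O', orientation O' & coherent_for sub (fun u v => sgn v u) C O'.
Proof.
apply: (not_aperiodicP (up_incidence G)) Oo => //.
- exact: up_component_neq0.
- exact: up_component_linked.
- exact: up_component_closed.
- exact: up_component_inc.
- apply/subsetP => u; rewrite !inE => /up_component_layer.
  by rewrite in_qlayer_cls.
- exact: up_walk_ge0.
- by move=> u u' uC; apply/up_walk_gt0/up_component_not_leaf.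
Qed.

Lemma down_walk_periodicP :
  ~ aperiodic_on (layer G k) (down_walk (R := R)) (lift_set D) <->
  exists2 O', orientation O' & coherent_for (fun u t => sub t u) sgn D O'.
Proof.
apply: (not_aperiodicP (down_incidence G)) Oo => //.
- exact: above_neq0.
- exact: above_linked.
- exact: above_closed.
- by move=> b /above_inc[a _ ab]; exists a.
- apply/subsetP => u; rewrite inE => /above_layer.
  by rewrite in_qlayer_cls [u \in layer _ _]inE.
- exact: down_walk_ge0.
- by move=> u u' uD; apply/down_walk_gt0/above_not_root.
Qed.

(** The pivot of the equivalences: the signs between [C] and [D] become trivial after switching
    signs of nodes, a condition treating both sides alike. *)
Definition balanced := exists eps del : qnode G -> bool,
  forall a b, a \in C -> b \in D -> qsub a b ->
    sgn (O b) (O a) = (-1) ^+ eps a * (-1) ^+ del b.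

Lemma up_balanced :
  (exists2 O', orientation O' & coherent_for sub (fun u v => sgn v u) C O') <->
  balanced.
Proof. exact: (coherent_balanced (up_incidence G) Oo above_intro). Qed.

Lemma down_balanced :
  (exists2 O', orientation O' & coherent_for (fun u t => sub t u) sgn D O') <->
  balanced.
Proof.
rewrite (coherent_balanced (D := C) (down_incidence G) Oo); last first.
  by move=> b a bD; apply: above_down.
by split=> -[eps [del bal]]; exists del, eps => a b aC bD ab;
  rewrite bal // mulrC.
Qed.

Definition wsgn (v u : G) : R := if sub u v then
  (sgn v u)%:~R * (Num.sqrt (Hratio R (cls v)) / Num.sqrt (Hratio R (cls u)))
  else 0.

Definition wsgn_mx : 'M[R]_(#|O @: D|, #|O @: C|) :=
  \matrix_(i, j) wsgn (enum_val i) (enum_val j).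

Let sqrtH_gt0 a : 0 < Num.sqrt (Hratio R a).
Proof. by rewrite sqrtr_gt0 Hratio_gt0. Qed.

Let sqrtH_neq0 a : Num.sqrt (Hratio R a) != 0.
Proof. by rewrite gt_eqF. Qed.

Lemma wsgn_norm a b : `|wsgn (O b) (O a)| =
  if qsub a b then Num.sqrt (Hratio R b) / Num.sqrt (Hratio R a) else 0.
Proof.
rewrite /wsgn !clsO subO; case: ifP => [ab|_]; last by rewrite normr0.
rewrite normrM [X in _ * X]gtr0_norm ?divr_gt0 //.
rewrite -subO in ab.
by case: (sgnP ab) => ->; rewrite ?rmorph1 ?rmorphN1 ?normrN normr1 mul1r.
Qed.

Lemma sum_enum_orient (E : {set qnode G}) (F : G -> R) :
  \sum_(i < #|O @: E|) F (enum_val i) = \sum_(a in E) F (O a).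
Proof.
rewrite -(big_enum_val F) big_imset //= => a b _ _; exact: orient_inj.
Qed.

Lemma enum_orient (E : {set qnode G}) (i : 'I_#|O @: E|) :
  exists2 a, a \in E & enum_val i = O a.
Proof. by have /imsetP := enum_valP i. Qed.

Lemma enum_orient_surj (E : {set qnode G}) a : a \in E ->
  exists i : 'I_#|O @: E|, enum_val i = O a.
Proof.
move=> aE; have Oa : O a \in O @: E by apply: imset_f.
by exists (enum_rank_in Oa (O a)); rewrite enum_rankK_in.
Qed.

Lemma A_up_gram : principal (O @: C) (A_up O (k - 1)) = - (wsgn_mx^T *m wsgn_mx).
Proof.
apply/matrixP => i j; rewrite !mxE.
under eq_bigr => l _ do rewrite !mxE.
rewrite (sum_enum_orient D (fun v => wsgn v (enum_val i) * wsgn v (enum_val j))).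
have [a aC ->] := enum_orient i; have [a' a'C ->] := enum_orient j.
rewrite /A_up !clsO; transitivity (- ((Num.sqrt (Hratio R a))^-1 *
   (Num.sqrt (Hratio R a'))^-1 * \sum_(b | qsub a b && qsub a' b)
   (sgn (O b) (O a))%:~R * (sgn (O b) (O a'))%:~R * Hratio R b)).
  case: ifPn => // /norP[nadj neq]; rewrite big1 ?mulr0 ?oppr0 //.
  move=> b /andP[ab a'b]; have [aa'|aa'] := eqVneq a a'.
    by move: neq; rewrite -aa' eqxx up_component_not_leaf.
  by case/negP: nadj; apply: up_adj_intro ab a'b => //; apply: up_component_layer.
congr (- _); rewrite mulr_sumr big_mkcond [RHS]big_mkcond; apply: eq_bigr => b _.
rewrite /wsgn !subO !clsO; case: ifPn => [/andP[ab a'b]|].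
  rewrite (above_intro aC ab) ab a'b.
  rewrite -[X in _ * (_ * X) = _]sqr_sqrtr ?ltW ?Hratio_gt0 //.
  by field; rewrite !sqrtH_neq0.
by case: ifP => // _; rewrite negb_and; case/orP => /negPf->; rewrite ?mulr0 ?mul0r.
Qed.

Lemma A_down_cogram : principal (O @: D) (A_down O k) = - (wsgn_mx *m wsgn_mx^T).
Proof.
apply/matrixP => i j; rewrite !mxE.
under eq_bigr => l _ do rewrite !mxE.
rewrite (sum_enum_orient C (fun u => wsgn (enum_val i) u * wsgn (enum_val j) u)).
have [b bD ->] := enum_orient i; have [b' b'D ->] := enum_orient j.
rewrite /A_down !clsO; transitivity (- (Num.sqrt (Hratio R b) *
   Num.sqrt (Hratio R b') * \sum_(a | qsub a b && qsub a b')
   (sgn (O b) (O a))%:~R * (sgn (O b') (O a))%:~R * (Hratio R a)^-1)).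
  case: ifPn => // /norP[nadj neq]; rewrite big1 ?mulr0 ?oppr0 //.
  move=> a /andP[ab ab']; have [bb'|bb'] := eqVneq b b'.
    by move: neq; rewrite -bb' eqxx above_not_root.
  by case/negP: nadj; apply: down_adj_intro ab ab' => //; apply: above_layer.
congr (- _); rewrite mulr_sumr big_mkcond [RHS]big_mkcond; apply: eq_bigr => a _.
rewrite /wsgn !subO !clsO; case: ifPn => [/andP[ab ab']|].
  rewrite (above_down bD ab) ab ab'.
  rewrite -[X in _ * (_ * X^-1) = _]sqr_sqrtr ?ltW ?Hratio_gt0 //.
  by field; rewrite !sqrtH_neq0.
by case: ifP => // _; rewrite negb_and; case/orP => /negPf->; rewrite ?mulr0 ?mul0r.
Qed.

Let g0 : 'cV[R]_#|O @: C| := restr_fun (O @: C) sqrtLR.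
Let f0 : 'cV[R]_#|O @: D| := restr_fun (O @: D) sqrtLR.

Lemma restr_sqrtLR_gt0 (E : {set G}) i :
  0 < (restr_fun E sqrtLR : 'cV[R]_#|E|) i 0.
Proof. by rewrite mxE sqrtLR_gt0. Qed.

(** Up to the factor [Num.sqrt (Hratio R b)], the row of [b] is the recursion for [RP]; the
    transposed equation is likewise the recursion for [LP]. *)
Lemma norm_wsgn_mx_sqrtLR : map_mx Num.norm wsgn_mx *m g0 = f0.
Proof.
apply/matrixP => i j; rewrite !mxE.
under eq_bigr => l _ do rewrite !mxE.
rewrite (sum_enum_orient C (fun u => `|wsgn (enum_val i) u| * sqrtLR u)).
have [b bD ->] := enum_orient i.
have -> : sqrtLR (O b) = Num.sqrt (Hratio R b) * RPR R b.
  by rewrite -[in RPR R b](clsO b) -sqrtLR_sqrtH clsO mulrC divfK.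
rewrite [in RPR R b]/RPR RPE (negPf (above_not_root bD)) natr_sum mulr_sumr.
rewrite big_mkcond [RHS]big_mkcond; apply: eq_bigr => a _; rewrite wsgn_norm.
have [ab|_] := boolP (qsub a b); last by rewrite mul0r if_same.
rewrite (above_down bD ab) -[in RHS]/(RPR R a) -(clsO a) -sqrtLR_sqrtH !clsO.
by rewrite mulrA mulrAC.
Qed.

Lemma norm_wsgn_mxT_sqrtLR : (map_mx Num.norm wsgn_mx)^T *m f0 = g0.
Proof.
apply/matrixP => i j; rewrite !mxE.
under eq_bigr => l _ do rewrite !mxE.
rewrite (sum_enum_orient D (fun v => `|wsgn v (enum_val i)| * sqrtLR v)).
have [a aC ->] := enum_orient i.
have -> : sqrtLR (O a) = (Num.sqrt (Hratio R a))^-1 * LPR R a.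
  by rewrite -[in LPR R a](clsO a) -sqrtH_sqrtLR clsO mulKf.
rewrite [in LPR R a]/LPR LPE (negPf (up_component_not_leaf aC)) natr_sum mulr_sumr.
rewrite big_mkcond [RHS]big_mkcond; apply: eq_bigr => b _; rewrite wsgn_norm.
have [ab|_] := boolP (qsub a b); last by rewrite mul0r if_same.
rewrite (above_intro aC ab) -[in RHS]/(LPR R b) -(clsO b) -sqrtH_sqrtLR !clsO.
by rewrite mulrAC mulrC.
Qed.

Lemma wsgn_neq0 a b : (wsgn (O b) (O a) != 0) = qsub a b.
Proof.
by rewrite -normr_eq0 wsgn_norm; case: ifP => _; rewrite ?eqxx // mulf_neq0 ?invr_eq0.
Qed.

Lemma wsgn_mx_connected (S : pred 'I_#|O @: C|) : (exists u, S u) ->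
  (forall v u u', wsgn_mx v u != 0 -> wsgn_mx v u' != 0 -> S u -> S u') ->
  forall u, S u.
Proof.
move=> [u0 Su0] step.
(* The predicate is moved from matrix indices to quotient nodes, where [up_component_linked]
   applies. *)
suff all a : a \in C -> [forall u, (enum_val u == O a) ==> S u].
  move=> u; have [a aC ua] := enum_orient u.
  by move/forallP/(_ u): (all a aC); rewrite ua eqxx.
move: a; apply: up_component_linked => [|a a' b aC a'C ab a'b /forallP Sa].
  have [a aC u0a] := enum_orient u0; exists a => //; apply/forallP => u.
  by apply/implyP => /eqP; rewrite -u0a => /enum_val_inj->.
apply/forallP => u'; apply/implyP => /eqP u'a'.
have [u ua] := enum_orient_surj aC.
have [v vb] := enum_orient_surj (above_intro aC ab).
apply: (step v u); rewrite ?mxE ?vb ?ua ?u'a' ?wsgn_neq0 //.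
by have := Sa u; rewrite ua eqxx.
Qed.

Let pairP := singular_pairP (@restr_sqrtLR_gt0 (O @: C)) (@restr_sqrtLR_gt0 (O @: D))
  norm_wsgn_mx_sqrtLR norm_wsgn_mxT_sqrtLR.

Lemma restr_sqrtLR_neq0 : g0 != 0.
Proof.
have /set0Pn[a aC] := up_component_neq0; have [u _] := enum_orient_surj aC.
by apply/eqP => /matrixP/(_ u 0)/eqP; rewrite [X in _ == X]mxE gt_eqF ?restr_sqrtLR_gt0.
Qed.

Lemma sg_wsgn a b : qsub a b ->
  Num.sg (wsgn (O b) (O a)) = (sgn (O b) (O a))%:~R.
Proof.
move=> ab; rewrite /wsgn subO ab sgrM [X in _ * X]gtr0_sg ?mulr1 ?divr_gt0 //.
by rewrite -subO in ab; case: (sgnP ab) => ->; rewrite ?rmorphN1 ?rmorph1 ?sgrN sgr1.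
Qed.

(** By [singular_pairP], only signs matter: those of a nowhere-zero pair [(g, f)] provide [eps] and
    [del], and conversely [sqrtLR] twisted by [eps] and [del] is a singular pair. *)
Lemma singular_pair_balanced :
  (exists g f, singular_pair wsgn_mx g f /\ g != 0) <-> balanced.
Proof.
split=> [[g [f [gf gn0]]]|[eps [del bal]]].
  have [gn fn] := singular_pair_neq0 (@restr_sqrtLR_gt0 _) (@restr_sqrtLR_gt0 _)
    norm_wsgn_mx_sqrtLR norm_wsgn_mxT_sqrtLR wsgn_mx_connected gf gn0.
  pose eps a := [exists u, (enum_val u == O a) && (g u 0 < 0)].
  pose del b := [exists v, (enum_val v == O b) && (f v 0 < 0)].
  exists eps, del => a b aC bD ab.
  have [[u ua] [v vb]] := (enum_orient_surj aC, enum_orient_surj bD).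
  have -> : eps a = (g u 0 < 0).
    apply/existsP/idP => [[u' /andP[/eqP]]|gu]; last by exists u; rewrite ua eqxx.
    by rewrite -ua => /enum_val_inj->.
  have -> : del b = (f v 0 < 0).
    apply/existsP/idP => [[v' /andP[/eqP]]|fv]; last by exists v; rewrite vb eqxx.
    by rewrite -vb => /enum_val_inj->.
  (* Taking signs in the balance relation removes the positive factors and leaves the sign of [f v]
     as that of [g u] times the signature. *)
  have /(congr1 Num.sg) := (pairP g f).1 gf v u.
  have w0 : wsgn (O b) (O a) != 0 by rewrite wsgn_neq0.
  rewrite !sgrM ![Num.sg (restr_fun _ _ _ _)]gtr0_sg ?restr_sqrtLR_gt0 //.
  rewrite mxE ua vb sgr_norm w0 !mulr1 mul1r sg_wsgn //.
  rewrite -!neqr0_sign // => e; apply: (@intr_inj R).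
  rewrite rmorphM !rmorph_sign /= mulrC e -mulrA -expr2 sqrr_sign mulr1 //.
pose g : 'cV[R]_#|O @: C| :=
  \col_i ((-1) ^+ eps (cls (enum_val i)) * sqrtLR (enum_val i)).
pose f : 'cV[R]_#|O @: D| :=
  \col_i ((-1) ^+ del (cls (enum_val i)) * sqrtLR (enum_val i)).
exists g, f; split.
  apply/pairP => v u; rewrite !mxE.
  have [[b bD ->] [a aC ->]] := (enum_orient v, enum_orient u).
  have [ab|nab] := boolP (qsub a b); last first.
    by move: nab; rewrite -wsgn_neq0 negbK => /eqP->; rewrite normr0 !mul0r.
  rewrite [X in _ = X * _ * _]numEsg sg_wsgn // bal // rmorphM !rmorph_sign !clsO.
  have e2 : (-1) ^+ eps a * (-1) ^+ eps a = 1 :> R by rewrite -expr2 sqrr_sign.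
  transitivity (((-1) ^+ eps a * (-1) ^+ eps a) * (-1) ^+ del b
    * `|wsgn (O b) (O a)| * sqrtLR (O a) * sqrtLR (O b)); last by ring.
  by rewrite e2; ring.
have /set0Pn[a aC] := up_component_neq0; have [u _] := enum_orient_surj aC.
apply/eqP => /matrixP/(_ u 0)/eqP; rewrite !mxE mulf_eq0 signr_eq0 /=.
by rewrite gt_eqF ?sqrtLR_gt0.
Qed.

(** With all signs equal to 1 the incidence matrix is its own absolute value, whose singular pair is
    [sqrtLR]. *)
Lemma restr_sqrtLR_pair :
  (forall a b, a \in C -> b \in D -> qsub a b -> sgn (O b) (O a) = 1) ->
  singular_pair wsgn_mx g0 f0.
Proof.
move=> sgn1; apply/pairP => v u; rewrite !mxE.
have [[b bD ->] [a aC ->]] := (enum_orient v, enum_orient u).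
have [ab|nab] := boolP (qsub a b); last first.
  by move: nab; rewrite -wsgn_neq0 negbK => /eqP->; rewrite normr0 !mul0r.
by rewrite [X in _ = X * _ * _]numEsg sg_wsgn // sgn1 // mul1r mulrAC.
Qed.

End Correspondence.

Theorem theorem1p52 (R : realType) (G : doubleCover) (k : int)
    (C : {set qnode G}) (O : qnode G -> G) :
  strong_grading G ->
  up_component (k - 1) C -> ~~ single_leaf C ->
  orientation O ->
  let D := above k C in
  let Aup : 'M[R]_#|O @: C| := principal (O @: C) (A_up O (k - 1)) in
  let Adown : 'M[R]_#|O @: D| := principal (O @: D) (A_down O k) in
  [/\ down_component k D /\ ~~ single_root D,
      [<-> ~ aperiodic_on (layer G (k - 1)) (up_walk (R := R)) (lift_set C);
           ~ aperiodic_on (layer G k) (down_walk (R := R)) (lift_set D);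
           eigenvalue Aup (-1);
           eigenvalue Adown (-1);
           coherent_up (k - 1) C;
           coherent_down k D],
      coherent_up (k - 1) C ->
        multiplicity_one Aup (-1) /\ multiplicity_one Adown (-1) &
      coherent_up_by (k - 1) C O ->
      (forall u v : G, u \in O @: C -> v \in O @: qlayer G k ->
         sub u v -> sgn v u = 1) ->
      (forall g : 'cV[R]_#|O @: C|, eigenvector Aup (-1) g <->
         exists2 c : R, c != 0 & g = c *: restr_fun (O @: C) sqrtLR) /\
      (forall f : 'cV[R]_#|O @: D|, eigenvector Adown (-1) f <->
         exists2 c : R, c != 0 & f = c *: restr_fun (O @: D) sqrtLR)].
Proof.
move=> strong Ccomp Cleaf Oo D Aup Adown.
(* Each of the six conditions is shown equivalent to [bal], directly or through the existence of a
   coherent orientation. *)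
pose bal := balanced k C O.
have upE := up_balanced strong Ccomp Oo.
have downE := down_balanced strong Ccomp Oo.
have pairE := singular_pair_balanced R strong Ccomp Cleaf Oo.
have AupE : Aup = _ := A_up_gram R strong Ccomp Cleaf Oo.
have AdownE : Adown = _ := A_down_cogram R strong Ccomp Oo.
have P1 := up_walk_periodicP R strong Ccomp Cleaf Oo.
have P2 := down_walk_periodicP R strong Ccomp Cleaf Oo.
have P3 : eigenvalue Aup (-1) <-> bal by rewrite AupE gram_eigenvalue.
have P4 : eigenvalue Adown (-1) <-> bal by rewrite AdownE cogram_eigenvalue.
have P5 := coherent_upE strong Ccomp Cleaf.
have P6 := coherent_downE strong Ccomp Cleaf.
have gn0 := restr_sqrtLR_neq0 R Ccomp O.
have pos E i := @restr_sqrtLR_gt0 R G E i.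
have w1 := norm_wsgn_mx_sqrtLR R strong Ccomp Oo.
have w2 := norm_wsgn_mxT_sqrtLR R strong Ccomp Cleaf Oo.
have conn := @wsgn_mx_connected R G k C strong Ccomp O Oo.
split.
- split; first exact: above_component.
  exact: above_not_single_root.
- by tfae; tauto.
- move=> /P5/upE/pairE[g [f [gf g_neq0]]]; rewrite AupE AdownE; split.
    exact: gram_multiplicity_one (pos _) (pos _) w1 w2 conn _ _ gf g_neq0.
  exact: cogram_multiplicity_one (pos _) (pos _) w1 w2 conn _ _ gf g_neq0.
move=> _ sgn1.
(* The normalization of the signs makes [sqrtLR] itself a singular pair; uniqueness up to a scalar
   then describes all eigenvectors. *)
have gf : singular_pair (wsgn_mx R k C O) (restr_fun (O @: C) sqrtLR)
    (restr_fun (O @: D) sqrtLR).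
  apply: restr_sqrtLR_pair => // a b aC bD ab; apply: sgn1.
  - exact: imset_f.
  - exact: imset_f (above_layer bD).
  - by rewrite -qsub_cls !cls_orient.
rewrite AupE AdownE; split.
  exact: (gram_eigenvectorP (pos _) (pos _) w1 w2 conn gf gn0).
exact: (cogram_eigenvectorP (pos _) (pos _) w1 w2 conn gf gn0).
Qed.
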